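(* Let $\mathbf{w}$ be an infinite binary word with factor complexity at most $2n$ (i.e., for every $n\ge1$, $\mathbf{w}$ has at most $2n$ distinct factors of length $n$) which avoids $(5/2)^+$-powers. Then, up to binary complement and/or reversal, the set of length-4 factors of $\mathbf{w}$ is exactly $\{0110,1001,0011,1100,0010,0100,1101,1010\}$; that is, this set of length-4 factors equals one of $F$, $\overline{F}$, $F^R$, $\overline{F^R}$ where $F=\{0110,1001,0011,1100,0010,0100,1101,1010\}$.
   Context: For a finite word of length $\ell$ with smallest period $p$, its exponent is $\ell/p$; a $(5/2)^+$-power is a word of exponent $>5/2$; a word avoids $(5/2)^+$-powers if none of its factors is a $(5/2)^+$-power. For a binary word $w$, $\overline{w}$ is its complement (exchange $0\leftrightarrow1$) and $w^R$ its reversal, extended to sets elementwise. *)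

(* Defs.v *)
From mathcomp Require Import all_boot all_order all_algebra.
From mathcomp Require Import boolp.

Set Implicit Arguments.
Unset Strict Implicit.
Unset Printing Implicit Defensive.

(* Letters are booleans, with 0 = false and 1 = true; an infinite binary word
   is a function nat -> bool. *)

Definition is_factor (w : nat -> bool) (u : seq bool) : Prop :=
  exists i : nat, u = [seq w (i + j) | j <- iota 0 (size u)].

Definition factors (w : nat -> bool) (n : nat) : {set n.-tuple bool} :=
  [set u : n.-tuple bool | `[< is_factor w u >]].

(* Every p >= size u satisfies the last condition vacuously, so that the
   smallest period of a nonempty word u lies between 1 and size u. *)
Definition is_period (u : seq bool) (p : nat) : bool :=
  (0 < p) && [forall i : 'I_(size u - p), nth false u (i + p) == nth false u i].

Lemma is_period_exists (u : seq bool) : exists p : nat, is_period u p.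
Proof.
exists (size u).+1; apply/forallP => -[i lti].
by exfalso; move: lti; rewrite subnS subnn.
Qed.

Definition smallest_period (u : seq bool) : nat := ex_minn (is_period_exists u).

Definition exponent (u : seq bool) : rat :=
  ((size u)%:R / (smallest_period u)%:R)%R.

Definition is_power_plus (e : rat) (u : seq bool) : bool := (e < exponent u)%R.

Definition avoids_power_plus (e : rat) (w : nat -> bool) : Prop :=
  forall u : seq bool, is_factor w u -> ~~ is_power_plus e u.

Definition complement_set (n : nat) (A : {set n.-tuple bool}) :
    {set n.-tuple bool} :=
  [set [tuple of map negb u] | u : n.-tuple bool in A].

Definition reversal_set (n : nat) (A : {set n.-tuple bool}) :
    {set n.-tuple bool} :=
  [set [tuple of rev u] | u : n.-tuple bool in A].

Definition F4 : {set 4.-tuple bool} :=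
  [set [tuple false; true;  true;  false];
       [tuple true;  false; false; true];
       [tuple false; false; true;  true];
       [tuple true;  true;  false; false];
       [tuple false; false; true;  false];
       [tuple false; true;  false; false];
       [tuple true;  true;  false; true];
       [tuple true;  false; true;  false]].

(* Main.v *)
Require Import Defs.
From mathcomp Require Import all_boot all_order all_algebra.
From mathcomp Require Import boolp zify.

(** A backtracking search over prefixes: every binary word of length 51 with
    no factor of period p <= 18 and exponent > 5/2, and with at most 2n factors
    of length n for n = 4 and n = 8, already has all eight words of one of the
    four sets among its factors of length 4, and by the complexity bound there
    is no room for a ninth. *)

Set Implicit Arguments.
Unset Strict Implicit.
Unset Printing Implicit Defensive.

Import Order.TTheory GRing.Theory Num.Theory.

Section Factors.
Variable w : nat -> bool.

Lemma is_factor_rev_take k n : k <= n ->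
  is_factor w (rev (take k (rev (mkseq w n)))).
Proof.
move=> le_kn; exists (n - k).
rewrite take_rev revK size_mkseq size_drop size_mkseq subKn //.
by rewrite /mkseq -map_drop drop_iota add0n subKn //
  -[X in iota X]addn0 iotaDl -map_comp.
Qed.

Lemma is_period_rev (u : seq bool) p : is_period u p -> is_period (rev u) p.
Proof.
case/andP=> p_gt0 /forallP per_u; rewrite /is_period p_gt0 /=.
apply/forallP=> -[i /=]; rewrite size_rev => lt_i.
(* Reversal turns the pair of positions [i], [i + p] into [j + p], [j] with
   [j = size u - p - i.+1]. *)
have lt_j : size u - p - i.+1 < size u - p by lia.
move: (per_u (Ordinal lt_j)) => /= /eqP; rewrite !nth_rev; [|lia|lia].
have -> : size u - p - i.+1 + p = size u - i.+1 by lia.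
have -> : size u - p - i.+1 = size u - (i + p).+1 by lia.
by move=> ->.
Qed.

(** Every period is at least the smallest one, so the exponent bound passes to any period, with
    denominators cleared. *)
Lemma avoids_period_size (a b : nat) (u : seq bool) p :
    avoids_power_plus (a%:R / b%:R)%R w -> 0 < b ->
    is_factor w u -> is_period u p ->
  b * size u <= a * p.
Proof.
move=> avoid_w b_gt0 /avoid_w; rewrite /is_power_plus /exponent -leNgt.
rewrite /smallest_period; case: ex_minnP => q per_q min_q size_u /min_q le_qp.
have /andP[q_gt0 _] := per_q.
move: size_u; rewrite ler_pdivrMr ?ltr0n // mulrAC ler_pdivlMr ?ltr0n //.
rewrite -!natrM ler_nat mulnC => /leq_trans; apply.
by rewrite leq_mul2l le_qp orbT.
Qed.

(* Words are stored with their last letter first. *)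
Definition known_factors k (L : seq (seq bool)) : Prop :=
  uniq L /\ forall u, u \in L -> size u = k /\ is_factor w (rev u).

Lemma known_factors_size k L : known_factors k L -> size L <= #|factors w k|.
Proof.
case=> uniqL facL; pose T := pmap (insub : _ -> option (k.-tuple bool)) (map rev L).
have uniqT : uniq T by rewrite pmap_sub_uniq // map_inj_uniq //; apply: inv_inj revK.
(* All stored words have length [k], so [insub] discards none of them. *)
have <- : size T = size L.
  rewrite size_pmap_sub -(size_map rev); apply/eqP; rewrite -all_count.
  by apply/allP=> _ /mapP[u /facL[<- _] ->]; rewrite size_rev.
rewrite -(card_uniqP uniqT); apply/subset_leq_card/subsetP=> t.
rewrite mem_pmap_sub => /mapP[u /facL[_ fac_u] tu].
by rewrite inE; apply/asboolP; rewrite tu.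
Qed.

End Factors.

(* [p + (3 * p)./2.+1] is the least length exceeding [5 p / 2]. *)
Definition power_suffix (s : seq bool) : bool :=
  has (fun pd => (pd.1 + pd.2 <= size s)
                 && (take pd.2 (drop pd.1 s) == take pd.2 s))
      [seq (p, (3 * p)./2.+1) | p <- iota 1 18].

Definition add_factor k (s : seq bool) (L : seq (seq bool)) :=
  if (k <= size s) && (take k s \notin L) then take k s :: L else L.

Definition F4_tuples : seq (4.-tuple bool) :=
  [:: [tuple false; true;  true;  false]; [tuple true;  false; false; true];
      [tuple false; false; true;  true];  [tuple true;  true;  false; false];
      [tuple false; false; true;  false]; [tuple false; true;  false; false];
      [tuple true;  true;  false; true];  [tuple true;  false; true;  false]].

Definition F4_words : seq (seq bool) := map val F4_tuples.

Definition targets : seq (seq (seq bool)) :=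
  [:: F4_words; map (map negb) F4_words; map rev F4_words;
      map (map negb) (map rev F4_words)].

(** The targets are spelled in reading order, the words of [L] backwards; hence [rev]. *)
Definition reached (L : seq (seq bool)) : bool :=
  has (all (fun u => rev u \in L)) targets.

(* Nested conditionals rather than [||] and [&&]: the virtual machine evaluates
   the arguments of boolean connectives eagerly, which would defeat pruning. *)
Definition settled (continue : seq bool -> seq (seq bool) -> seq (seq bool) -> bool)
    s L4 L8 : bool :=
  if power_suffix s then true else
  let M4 := add_factor 4 s L4 in
  if 8 < size M4 then true else
  let M8 := add_factor 8 s L8 in
  if 16 < size M8 then true else
  if reached M4 then true else continue s M4 M8.

(** The value is true when each branch is pruned or reaches a target within [fuel] more letters;
    exhausted fuel counts as failure. *)
Fixpoint search fuel (s : seq bool) (L4 L8 : seq (seq bool)) : bool :=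
  if fuel is m.+1 then
    if settled (search m) (true :: s) L4 L8
    then settled (search m) (false :: s) L4 L8 else false
  else false.

Lemma search_true : search 51 [::] [::] [::].
Proof. by vm_compute. Qed.

(** Two equal windows of length [d] at distance [p] form a factor of length [p + d] with period [p],
    which is too long for exponent 5/2. *)
Lemma power_suffixF w n :
  avoids_power_plus (5%:R / 2%:R)%R w -> power_suffix (rev (mkseq w n)) = false.
Proof.
move=> avoid_w; apply/negP=> /hasP[_ /mapP[p p_gt0 ->] /=].
rewrite mem_iota in p_gt0; have {}p_gt0 : 0 < p by lia.
set d := (3 * p)./2.+1; set s := rev (mkseq w n); case/andP=> le_size /eqP eq_take.
have := @avoids_period_size w 5 2 (rev (take (p + d) s)) p avoid_w isT.
have le_n : p + d <= n by move: le_size; rewrite size_rev size_mkseq.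
move=> /(_ (is_factor_rev_take w le_n)).
have size_u : size (take (p + d) s) = p + d by rewrite size_takel.
suff per_u : is_period (take (p + d) s) p.
  move=> /(_ (is_period_rev per_u)); rewrite size_rev size_u.
  (* Rounding gives [3 * p < 2 * d], hence [5 * p < 2 * (p + d)]. *)
  have := odd_double_half (3 * p); rewrite /d; lia.
rewrite /is_period p_gt0; apply/forallP=> -[i /=]; rewrite size_u addKn => lt_i.
rewrite !nth_take; [|lia|lia].
by rewrite addnC -nth_drop -(nth_take false lt_i (drop p s)) eq_take nth_take.
Qed.

Lemma known_add_factor w n k L : known_factors w k L ->
  known_factors w k (add_factor k (rev (mkseq w n)) L).
Proof.
rewrite /add_factor; case: ifP => // /andP[le_kn notinL] [uniqL facL].
split=> [|u]; first by rewrite /= notinL.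
rewrite inE => /predU1P[-> | /facL //]; split; first by rewrite size_takel.
by apply: is_factor_rev_take; rewrite size_rev size_mkseq in le_kn.
Qed.

(** Induction on the fuel along the branch spelled by [w] itself: no pruning test can fire there, so
    a successful search must end at [reached]. *)
Lemma search_sound w fuel n L4 L8 :
    avoids_power_plus (5%:R / 2%:R)%R w ->
    #|factors w 4| <= 8 -> #|factors w 8| <= 16 ->
    known_factors w 4 L4 -> known_factors w 8 L8 ->
    search fuel (rev (mkseq w n)) L4 L8 ->
  exists2 L, known_factors w 4 L & reached L.
Proof.
move=> avoid_w card4 card8; elim: fuel n L4 L8 => // m IHm n L4 L8 known4 known8 /=.
case: ifP => // settled_true settled_false.
have {settled_true settled_false} :
    settled (search m) (w n :: rev (mkseq w n)) L4 L8 by case: (w n).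
rewrite -rev_rcons -mkseqS.
have known4' := known_add_factor n.+1 known4.
have known8' := known_add_factor n.+1 known8.
rewrite /settled power_suffixF // !ltnNge.
rewrite (leq_trans (known_factors_size known4') card4).
rewrite (leq_trans (known_factors_size known8') card8) /=.
by case: ifP => [? _ | _]; [exists (add_factor 4 (rev (mkseq w n.+1)) L4) | apply: IHm].
Qed.

Lemma mem_F4 : F4 =i F4_tuples.
Proof. by move=> u; rewrite !inE !orbA. Qed.

Lemma card_F4 : #|F4| = 8.
Proof. by rewrite (eq_card mem_F4); apply/card_uniqP. Qed.

Lemma F4_word u : u \in F4 -> val u \in F4_words.
Proof. by rewrite mem_F4; apply: map_f. Qed.

Lemma card_complement_set n (A : {set n.-tuple bool}) : #|complement_set A| = #|A|.
Proof.
apply/card_imset=> u v /(congr1 val) /= eq_uv; apply/val_inj.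
exact: (inj_map (inv_inj negbK)) eq_uv.
Qed.

Lemma card_reversal_set n (A : {set n.-tuple bool}) : #|reversal_set A| = #|A|.
Proof.
apply/card_imset=> u v /(congr1 val) /= eq_uv; apply/val_inj.
exact: (inv_inj revK) eq_uv.
Qed.

(** All of [A] occurs in [w], and [A] already has the maximal number 8 of elements, so the inclusion
    is an equality. *)
Lemma factors_eq_target w (A : {set 4.-tuple bool}) (T L : seq (seq bool)) :
    #|factors w 4| <= 8 -> #|A| = 8 -> {in A, forall u, val u \in T} ->
    known_factors w 4 L -> all (fun u => rev u \in L) T ->
  factors w 4 = A.
Proof.
move=> card4 cardA subT [_ facL] /allP TL; apply/esym/eqP.
rewrite eqEcard cardA card4 andbT; apply/subsetP=> u /subT /TL /facL[_].
by rewrite revK inE => fac_u; apply/asboolP.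
Qed.

Theorem theorem4 (w : nat -> bool)
  (hcomplexity : forall n : nat, 0 < n -> #|factors w n| <= 2 * n)
  (havoid : avoids_power_plus (5%:R / 2%:R)%R w) :
  [\/ factors w 4 = F4,
      factors w 4 = complement_set F4,
      factors w 4 = reversal_set F4
    | factors w 4 = complement_set (reversal_set F4)].
Proof.
have card4 : #|factors w 4| <= 8 by apply: hcomplexity.
have card8 : #|factors w 8| <= 16 by apply: hcomplexity.
have known0 k : known_factors w k [::] by [].
have [L knownL] := @search_sound w 51 0 _ _ havoid card4 card8
  (known0 4) (known0 8) search_true.
have eq_target A T := @factors_eq_target w A T L card4.
have memR u : u \in reversal_set F4 -> val u \in map rev F4_words.
  by case/imsetP=> v /F4_word F4v ->; exact: (map_f rev F4v).
(* The entries of [targets] come in the order of the four alternatives. *)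
case/hasP=> T; rewrite !inE => /or4P[] /eqP-> allL.
- by constructor 1; apply: (eq_target _ _ _ _ knownL allL);
     [apply: card_F4 | apply: F4_word].
- constructor 2; apply: (eq_target _ _ _ _ knownL allL).
    by rewrite card_complement_set card_F4.
  by move=> _ /imsetP[v /F4_word F4v ->]; exact: (map_f (map negb) F4v).
- constructor 3; apply: (eq_target _ _ _ _ knownL allL); last exact: memR.
  by rewrite card_reversal_set card_F4.
- constructor 4; apply: (eq_target _ _ _ _ knownL allL).
    by rewrite card_complement_set card_reversal_set card_F4.
  by move=> _ /imsetP[v /memR F4v ->]; exact: (map_f (map negb) F4v).
Qed.
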